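(* Let $n\ge1$ and $q\ge2$ be integers, let $t\in\mathbb{Z}/q\mathbb{Z}$, and let $\Lambda=\Lambda(n,q,t)$ be the associated domino $2$-graph. Then: (1) The red graph $R\Lambda=(\Lambda^0,\Lambda^{e_2},r,s)$ is the complete directed graph $K_{q^{n-1}}$ on $q^{n-1}$ vertices, so that for all $u,v\in\Lambda^0$ there is exactly one $f\in\Lambda^{e_2}$ with $r(f)=v$ and $s(f)=u$. (2) $\Lambda^0$ can be identified, via $v\mapsto v(0)v(e_1)\cdots v((n-1)e_1)$, with the set $A^n_t$ of words of length $n$ and trace $t\pmod q$ over the alphabet $A=\mathbb{Z}/q\mathbb{Z}$. (3) The blue graph $B\Lambda=(\Lambda^0,\Lambda^{e_1},r,s)$ consists of disjoint cycles whose lengths divide $n$, and which correspond (under the identification in (2), by taking the set of vertices on a cycle) to the necklaces of $A^n_t$. For each divisor $d$ of $n$, the number $h_d$ of blue cycles of length $d$ in $\Lambda$ is \[ h_d=\sum_{s\in\mathbb{Z}/q\mathbb{Z},\ (n/d)s\equiv t\ (\mathrm{mod}\ q)}L_q(d,s), \] where $L_q(d,s)$ is the number of Lyndon words of length $d$ with trace $s\pmod q$ over $A$.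
   Context: **$k$-graphs.** A $k$-graph is a countable category $\Lambda$ with a functor $d:\Lambda\to\mathbb{N}^k$ (the degree map) satisfying the factorisation property: if $d(\lambda)=m+p$, there are unique $\mu,\nu\in\Lambda$ with $d(\mu)=m$, $d(\nu)=p$ and $\lambda=\mu\nu$. Here $s,r$ are the domain and codomain maps, $\Lambda^m:=d^{-1}(m)$, and objects are identified with $\Lambda^0$. An edge $e$ goes from $s(e)$ to $r(e)$. **Domino graphs.** Let $n\ge1$, $q\ge2$ be integers and $t\in\mathbb{Z}/q\mathbb{Z}$. Let $T=\{0,e_1,2e_1,\dots,(n-1)e_1\}\subset\mathbb{N}^2$, and for $m\in\mathbb{N}^2$ let $T(m)=\bigcup_{0\le l\le m}(T+l)$. For a function $f$ whose domain contains $T+l$, define $f|_{T+l}:T\to\mathbb{Z}/q\mathbb{Z}$ by $f|_{T+l}(i)=f(i+l)$. The domino graph $\Lambda=\Lambda(n,q,t)$ is the $2$-graph with vertex set $\Lambda^0=\{v:T\to\mathbb{Z}/q\mathbb{Z}:\sum_{i\in T}v(i)=t\}$; a path of degree $m$ is a function $\lambda:T(m)\to\mathbb{Z}/q\mathbb{Z}$ such that $\lambda|_{T+l}\in\Lambda^0$ for all $0\le l\le m$, with $r(\lambda)=\lambda|_T$ and $s(\lambda)=\lambda|_{T+m}$. If $\mu\in\Lambda^m$, $\nu\in\Lambda^p$ and $s(\mu)=r(\nu)$, then $\mu\nu$ is the unique path $\lambda$ of degree $m+p$ with $\lambda(i)=\mu(i)$ for $i\in T(m)$ and $\lambda(i+m)=\nu(i)$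 for $i\in T(p)$. It is known that this is a $2$-graph. Elements of $\Lambda^{e_1}$ are called blue edges and elements of $\Lambda^{e_2}$ red edges. The complete directed graph on $N$ vertices, $K_N$, has exactly one edge from each vertex to each vertex (including one loop at each vertex). **Necklaces and Lyndon words.** The trace of a word over $A=\mathbb{Z}/q\mathbb{Z}$ (with symbols ordered $0<1<\dots<q-1$) is the sum of its symbols mod $q$. Define $\rho(a_1\cdots a_n)=a_2\cdots a_na_1$ on words of length $n$. Necklaces of length $n$ are the orbits of $\rho$ (the trace is constant on each orbit, and the necklaces of $A^n_t$ are those contained in $A^n_t$). The period of a necklace $[a]$ is the smallest $d\geq 1$ with $\rho^d(a)=a$; a necklace is aperiodic if its period equals its length, and a Lyndon word is the lexicographically least representative of an aperiodic necklace. It is known that $L_q(n,t)=\frac{1}{qn}\sum_{d\mid n,\ \gcd(d,q)\mid t}\gcd(d,q)\mu(d)q^{n/d}$, where $\mu$ is the Möbius function. *)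

(* Defs.v *)
From HB Require Import structures.
From mathcomp Require Import all_boot all_order all_algebra.

Set Implicit Arguments.
Unset Strict Implicit.
Unset Printing Implicit Defensive.

Import Order.TTheory GRing.Theory.

(* An edge e goes from src e to rng e. *)
Record digraph := Digraph {
  vert : finType;
  edge : finType;
  rng : edge -> vert;
  src : edge -> vert
}.

Definition digraph_iso (G H : digraph) : Prop :=
  exists (f : vert G -> vert H) (g : edge G -> edge H),
    [/\ bijective f, bijective g,
        forall e, rng (g e) = f (rng e) & forall e, src (g e) = f (src e)].

Definition complete_digraph (N : nat) : digraph :=
  @Digraph 'I_N ('I_N * 'I_N)%type snd fst.

(* A cycle is a subgraph, recorded as its vertex set and its edge set, so that
   the choice of a starting point is irrelevant.  Cycles of length d are the
   embedded copies of the directed cycle on 'I_d, where ordS is the cyclic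
   successor; d = 1 gives the loops. *)
Definition cycles_of_length (G : digraph) (d : nat) :
    {set {set vert G} * {set edge G}} :=
  [set C | (0 < d) &&
    [exists v : {ffun 'I_d -> vert G}, exists e : {ffun 'I_d -> edge G},
      [&& injectiveb v,
          [forall i, (src (e i) == v i) && (rng (e i) == v (ordS i))] &
          C == ([set v i | i : 'I_d], [set e i | i : 'I_d])]]].

Definition is_cycle (G : digraph) (C : {set vert G} * {set edge G}) : Prop :=
  exists d, C \in cycles_of_length G d.

Definition disjoint_union_of_cycles (G : digraph) : Prop :=
  (forall x : vert G, exists! C, is_cycle C /\ x \in C.1) /\
  (forall e : edge G, exists! C, is_cycle C /\ e \in C.2).

Definition padd (i l : nat * nat) : nat * nat := (i.1 + l.1, i.2 + l.2).

Definition box (m : nat * nat) : seq (nat * nat) :=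
  [seq (a, b) | a <- iota 0 m.1.+1, b <- iota 0 m.2.+1].

Definition tile (n : nat) : seq (nat * nat) := [seq (i, 0) | i <- iota 0 n].

(* T(m); entries may repeat, but only membership matters in seq_sub. *)
Definition tiles (n : nat) (m : nat * nat) : seq (nat * nat) :=
  [seq padd i l | i <- tile n, l <- box m].

Lemma mem_tile (n : nat) (i : 'I_n) : (val i, 0) \in tile n.
Proof. by apply: map_f; rewrite mem_iota ltn_ord. Qed.

Lemma mem_box (m l : nat * nat) :
  (l \in box m) = (l.1 <= m.1) && (l.2 <= m.2).
Proof.
case: l => a b; apply/allpairsP/andP => [[[x y] []]|[Ha Hb]].
  by rewrite !mem_iota !add0n !ltnS => /= Hx Hy [-> ->].
by exists (a, b); split=> //; rewrite mem_iota add0n ltnS.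
Qed.

Lemma mem0_box (m : nat * nat) : (0, 0) \in box m.
Proof. by rewrite mem_box. Qed.

Lemma memm_box (m : nat * nat) : m \in box m.
Proof. by rewrite mem_box !leqnn. Qed.

Lemma mem_tiles (n : nat) (m : nat * nat)
    (i : seq_sub (tile n)) (l : seq_sub (box m)) :
  padd (ssval i) (ssval l) \in tiles n m.
Proof. exact: allpairs_f (ssvalP i) (ssvalP l). Qed.

(* The restriction of f to T + l, as a function on T. *)
Definition restr (n q : nat) (m : nat * nat)
    (f : {ffun seq_sub (tiles n m) -> 'Z_q}) (l : seq_sub (box m)) :
    {ffun seq_sub (tile n) -> 'Z_q} :=
  [ffun i => f (SeqSub (mem_tiles i l))].

Definition is_vertex (n q : nat) (t : 'Z_q) :
    pred {ffun seq_sub (tile n) -> 'Z_q} :=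
  fun v => (\sum_i v i == t)%R.

Definition vertex (n q : nat) (t : 'Z_q) : finType :=
  {v : {ffun seq_sub (tile n) -> 'Z_q} | is_vertex t v}.

Definition is_path (n q : nat) (t : 'Z_q) (m : nat * nat) :
    pred {ffun seq_sub (tiles n m) -> 'Z_q} :=
  fun f => [forall l : seq_sub (box m), is_vertex t (restr f l)].

Definition dpath (n q : nat) (t : 'Z_q) (m : nat * nat) : finType :=
  {f : {ffun seq_sub (tiles n m) -> 'Z_q} | is_path t f}.

Definition path_vertex (n q : nat) (t : 'Z_q) (m : nat * nat)
    (f : dpath n t m) (l : seq_sub (box m)) : vertex n t :=
  exist _ (restr (val f) l) (forallP (valP f) l).

Definition path_rng (n q : nat) (t : 'Z_q) (m : nat * nat)
    (f : dpath n t m) : vertex n t :=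
  path_vertex f (SeqSub (mem0_box m)).

Definition path_src (n q : nat) (t : 'Z_q) (m : nat * nat)
    (f : dpath n t m) : vertex n t :=
  path_vertex f (SeqSub (memm_box m)).

(* The directed graph (Lambda^0, Lambda^m, r, s). *)
Definition skeleton (n q : nat) (t : 'Z_q) (m : nat * nat) : digraph :=
  @Digraph (vertex n t) (dpath n t m) (@path_rng n q t m) (@path_src n q t m).

Definition blue_graph (n q : nat) (t : 'Z_q) : digraph := skeleton n t (1, 0).

Definition red_graph (n q : nat) (t : 'Z_q) : digraph := skeleton n t (0, 1).

Definition trace (n q : nat) (w : n.-tuple 'Z_q) : 'Z_q :=
  (\sum_(a <- w) a)%R.

(* A^n_t *)
Definition words (n q : nat) (t : 'Z_q) : {set n.-tuple 'Z_q} :=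
  [set w | trace w == t].

Definition word_of (n q : nat) (t : 'Z_q) (v : vertex n t) : n.-tuple 'Z_q :=
  [tuple val v (SeqSub (mem_tile i)) | i < n].

(* The necklace attached to a blue cycle: the words read at its vertices. *)
Definition cycle_words (n q : nat) (t : 'Z_q)
    (C : {set vert (blue_graph n t)} * {set edge (blue_graph n t)}) :
    {set n.-tuple 'Z_q} :=
  [set word_of v | v in C.1].

Definition rho (n q : nat) (w : n.-tuple 'Z_q) : n.-tuple 'Z_q :=
  [tuple of rot 1 w].

Definition necklace (n q : nat) (w : n.-tuple 'Z_q) : {set n.-tuple 'Z_q} :=
  [set b in orbit (@rho n q) w].

Definition necklaces (n q : nat) (t : 'Z_q) : {set {set n.-tuple 'Z_q}} :=
  [set N in [set necklace w | w : n.-tuple 'Z_q] | N \subset words n t].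

Lemma rho_inj (n q : nat) : injective (@rho n q).
Proof. by move=> a b /(congr1 val) /= /rot_inj /val_inj. Qed.

Lemma period_exists (n q : nat) (w : n.-tuple 'Z_q) :
  exists d, (0 < d) && (iter d (@rho n q) w == w).
Proof.
exists (order (@rho n q) w).
by rewrite order_gt0 iter_order ?eqxx //; apply: rho_inj.
Qed.

Definition period (n q : nat) (w : n.-tuple 'Z_q) : nat :=
  ex_minn (period_exists w).

Definition lyndon (n q : nat) (w : n.-tuple 'Z_q) : bool :=
  (period w == n) &&
  [forall b in necklace w,
    ((w : n.-tuplelexi 'Z_q) <= (b : n.-tuplelexi 'Z_q))%O].

Definition lyndon_count (q d : nat) (s : 'Z_q) : nat :=
  #|[set w : d.-tuple 'Z_q | lyndon w && (trace w == s)]|.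

(* Main.v *)
(* The two rows of a red edge are disjoint copies of T, so a red edge is an
   arbitrary pair of vertices.  A blue edge is a word of length n + 1 whose two
   factors of length n have equal trace, so its first and last symbols agree
   and its source is the rotation of its range: blue cycles are the orbits of
   the rotation, that is, necklaces.  A necklace of size d is the necklace of
   u ^ (n/d) for a unique Lyndon word u of length d, and the trace of u ^ (n/d)
   is n/d times that of u. *)
Require Import Defs.
From HB Require Import structures.
From mathcomp Require Import all_boot all_order all_algebra.

Set Implicit Arguments.
Unset Strict Implicit.
Unset Printing Implicit Defensive.

Import GRing.Theory.

(** * Orbits of injective maps *)

(** [necklace] is convertible to [orb] of [rho], so these orbit facts apply to necklaces
    directly. *)
Definition orb (T : finType) (f : T -> T) (x : T) : {set T} :=
  [set y in orbit f x].

Lemma mem_orb (T : finType) (f : T -> T) (x y : T) :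
  (y \in orb f x) = fconnect f x y.
Proof. by rewrite inE fconnect_orbit. Qed.

Lemma orb_id (T : finType) (f : T -> T) (x : T) : x \in orb f x.
Proof. by rewrite mem_orb connect0. Qed.

Lemma card_orb (T : finType) (f : T -> T) (x : T) : #|orb f x| = order f x.
Proof. by apply: eq_card => y; rewrite mem_orb. Qed.

Lemma orbP (T : finType) (f : T -> T) (x y : T) :
  reflect (exists k, y = iter k f x) (y \in orb f x).
Proof.
rewrite mem_orb; apply: (iffP idP) => [xy|[k ->]]; last exact: fconnect_iter.
by exists (findex f x y); rewrite iter_findex.
Qed.

Lemma orb_eq (T : finType) (f : T -> T) (x y : T) :
  injective f -> y \in orb f x -> orb f y = orb f x.
Proof.
move=> injf; rewrite mem_orb => xy; apply/setP => z; rewrite !mem_orb.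
by rewrite -(same_connect (fconnect_sym injf) xy).
Qed.

(** Whole turns of the orbit fix [x], so only the remainder of [m] modulo the order matters, and
    [findex] shows that it must be 0. *)
Lemma iter_eq_order (T : finType) (f : T -> T) (x : T) (m : nat) :
  injective f -> (iter m f x == x) = (order f x %| m).
Proof.
move=> injf; have iterM k : iter (k * order f x) f x = x.
  by elim: k => // k IH; rewrite mulSn iterD IH iter_order.
rewrite {1}(divn_eq m (order f x)) addnC iterD iterM /dvdn.
apply/eqP/eqP => [fix_x|-> //].
by rewrite -(findex_iter (ltn_pmod m (order_gt0 f x))) fix_x findex0.
Qed.

Lemma iter_morph (T U : Type) (f : T -> T) (g : U -> U) (h : T -> U) :
  (forall x, h (f x) = g (h x)) ->
  forall k x, h (iter k f x) = iter k g (h x).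
Proof. by move=> hf; elim=> // k IH x; rewrite !iterS hf IH. Qed.

(** Serves twice: for [word_of], from [shift] to [rho], and for [periodic_word], from rotation in
    length [d] to rotation in length [n]. *)
Lemma orb_morph (T U : finType) (f : T -> T) (g : U -> U) (h : T -> U) :
  (forall x, h (f x) = g (h x)) -> forall x, orb g (h x) = h @: orb f x.
Proof.
move=> hf x; apply/setP => y; apply/orbP/imsetP => [[k ->]|[_ /orbP[k ->] ->]].
  by exists (iter k f x); [apply/orbP; exists k | rewrite (iter_morph hf)].
by exists k; rewrite (iter_morph hf).
Qed.

Lemma order_morph (T U : finType) (f : T -> T) (g : U -> U) (h : T -> U) :
  injective h -> (forall x, h (f x) = g (h x)) ->
  forall x, order g (h x) = order f x.
Proof.
by move=> injh hf x; rewrite -!card_orb (orb_morph hf) card_imset.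
Qed.

(** * Digraphs in which every vertex has one incoming edge *)

Section FunctionalDigraph.

Variables (G : digraph) (S : vert G -> vert G).
Hypothesis injS : injective S.
Hypothesis rng_bij : bijective (@rng G).
Hypothesis srcE : forall e : edge G, src e = S (rng e).

(** The single edge entering a vertex of the orbit also starts in the orbit, so these edges form a
    subgraph on it. *)
Definition orb_cycle (x : vert G) : {set vert G} * {set edge G} :=
  (orb S x, [set e | rng e \in orb S x]).

(* Edges point against S, so a cycle visits an S-orbit backwards. *)
Lemma cycles_of_lengthP (d : nat) (C : {set vert G} * {set edge G}) :
  C \in cycles_of_length G d <-> exists2 x, order S x = d & C = orb_cycle x.
Proof.
rewrite inE; split=> [|[x <- ->{d C}]].
  case/andP=> d_gt0 /existsP[v /existsP[e /and3P[/injectiveP injv]]].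
  move=> /forallP ve /eqP ->.
  (* The edge [e (ord_pred i)] ends at [v i], so by [srcE] its source is [S (v i)]. *)
  have predE i : v (ord_pred i) = S (v i).
    case/andP: (ve (ord_pred i)) => /eqP <- /eqP.
    by rewrite srcE ord_predK => ->.
  have nextE i : S (v (ordS i)) = v i by rewrite -predE ordSK.
  pose x := v (Ordinal d_gt0).
  (* Each [v k] is joined to [x] by [S], in a direction that injectivity makes reversible;
     conversely the image of [v] contains [x] and is closed under [S]. *)
  have orbE : [set v i | i : 'I_d] = orb S x.
    apply/eqP; rewrite eqEsubset; apply/andP; split; apply/subsetP => y.
      case/imsetP=> -[k lt_kd] _ ->{y}; elim: k lt_kd => [|k IH] lt_kd.
        by rewrite (_ : v _ = x) ?orb_id //; congr (v _); apply: val_inj.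
      have lt_kd' := ltnW lt_kd; move: (IH lt_kd').
      rewrite -nextE !mem_orb; set z := v (ordS _).
      have -> : z = v (Ordinal lt_kd).
        by congr (v _); apply: val_inj; rewrite /= modn_small.
      move=> xSz; apply: (connect_trans xSz).
      by rewrite fconnect_sym // fconnect1.
    case/orbP=> k ->{y}; elim: k => [|k /imsetP[i _ IH]].
      by apply: imset_f.
    by rewrite iterS IH -predE imset_f.
  exists x; first by rewrite -card_orb -orbE card_imset // card_ord.
  rewrite /orb_cycle -orbE; congr pair; apply/setP => a; rewrite inE.
  apply/imsetP/imsetP => [[i _ ->]|[i _ ai]].
    by exists (ordS i) => //; case/andP: (ve i) => _ /eqP.
  (* Two edges with range [v i] coincide. *)
  exists (ord_pred i) => //; apply: (bij_inj rng_bij); rewrite ai.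
  by case/andP: (ve (ord_pred i)) => _ /eqP ->; rewrite ord_predK.
have [edge_of edge_ofK rngK] := rng_bij.
(* Following an edge applies the inverse of [S], so the cycle visits the iterates of [P] at [x], and
   [e i] is the only edge into [v (ordS i)]. *)
pose P := finv S; have injP : injective P by apply: finv_inj.
rewrite order_gt0 /=; pose v := [ffun i : 'I_(order S x) => iter i P x].
pose e := [ffun i => edge_of (v (ordS i))].
have ltP (i : 'I_(order S x)) : i < order P x by rewrite order_finv.
have vS i : v (ordS i) = P (v i).
  (* At the last index [ordS] wraps to 0, and [P] iterated [order S x] times fixes [x]. *)
  rewrite !ffunE /= -iterS; have := ltn_ord i; rewrite leq_eqVlt.
  case/predU1P=> [->|lt_i]; last by rewrite modn_small.
  by rewrite modnn -(order_finv injS) iter_order.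
have injv : injective v.
  move=> i j; rewrite !ffunE => /(congr1 (findex P x)).
  by rewrite !findex_iter // => /val_inj.
have orbE : orb S x = [set v i | i : 'I_(order S x)].
  apply/esym/eqP; rewrite eqEcard card_orb card_imset // card_ord leqnn andbT.
  apply/subsetP=> _ /imsetP[i _ ->]; rewrite mem_orb ffunE.
  by rewrite -same_fconnect_finv // fconnect_iter.
apply/existsP; exists v; apply/existsP; exists e; apply/and3P; split.
- exact/injectiveP.
- apply/forallP=> i; rewrite srcE [e i]ffunE rngK eqxx vS f_finv //.
  by rewrite eqxx.
rewrite /orb_cycle -orbE; apply/eqP; congr pair; apply/setP => a.
rewrite inE orbE; apply/imsetP/imsetP => [[i _ ai]|[i _ ->]].
  exists (ord_pred i) => //; rewrite ffunE ord_predK -ai edge_ofK //.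
by exists (ordS i) => //; rewrite ffunE rngK.
Qed.

Lemma is_cycleP (C : {set vert G} * {set edge G}) :
  is_cycle C <-> exists x, C = orb_cycle x.
Proof.
split=> [[d /cycles_of_lengthP[x _ ->]]|[x ->]]; first by exists x.
by exists (order S x); apply/cycles_of_lengthP; exists x.
Qed.

Lemma orb_cycle_eq (x y : vert G) :
  x \in orb S y -> orb_cycle x = orb_cycle y.
Proof. by rewrite /orb_cycle => /(orb_eq injS) ->. Qed.

(** Orbits of an injective map partition the vertices, and an edge lies only on the cycle of its
    range. *)
Lemma functional_disjoint_union_of_cycles : disjoint_union_of_cycles G.
Proof.
split=> [x|e]; [exists (orb_cycle x)|exists (orb_cycle (rng e))].
  split=> [|C [/is_cycleP[y ->]]]; last exact: orb_cycle_eq.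
  by split; [apply/is_cycleP; exists x | apply: orb_id].
split=> [|C [/is_cycleP[y ->]]].
  by split; [apply/is_cycleP; exists (rng e) | rewrite inE orb_id].
by rewrite inE => /orb_cycle_eq.
Qed.

End FunctionalDigraph.

(** * Bijections between finite types *)

Lemma inj_surj_bij (T U : finType) (f : T -> U) :
  injective f -> (forall y, exists x, f x = y) -> bijective f.
Proof.
move=> injf surjf; apply: inj_card_bij => //.
rewrite -(card_codom injf); apply/subset_leq_card/subsetP => y _.
by have [x <-] := surjf y; apply: codom_f.
Qed.

(** * Vertices as words *)

Lemma tile_index_bij (n : nat) :
  bijective (fun i : 'I_n => SeqSub (mem_tile i) : seq_sub (tile n)).
Proof.
apply: inj_card_bij => [i j /(congr1 (@ssval _ _)) [] /val_inj //|].
rewrite card_seq_sub ?size_map ?size_iota ?card_ord //.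
by rewrite map_inj_uniq ?iota_uniq // => a b [].
Qed.

Lemma sum_tile (n q : nat) (F : seq_sub (tile n) -> 'Z_q) :
  (\sum_x F x = \sum_(i < n) F (SeqSub (mem_tile i)))%R.
Proof. by rewrite (reindex _ (onW_bij _ (tile_index_bij n))). Qed.

Lemma traceE (n q : nat) (w : n.-tuple 'Z_q) :
  trace w = (\sum_(i < n) tnth w i)%R.
Proof. by rewrite /trace big_tuple. Qed.

Lemma trace_word_of (n q : nat) (t : 'Z_q) (v : vertex n t) :
  trace (word_of v) = t.
Proof.
rewrite traceE -[RHS](eqP (valP v)) sum_tile.
by apply: eq_bigr => i _; rewrite tnth_mktuple.
Qed.

(** Reads [v] at an abstract point of the tile through its first coordinate, which is below [n], so
    the default 0 is never reached. *)
Lemma nth_word_of (n q : nat) (t : 'Z_q) (v : vertex n t)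
    (x : seq_sub (tile n)) :
  val v x = nth 0%R (word_of v) (ssval x).1.
Proof.
have [g _ gK] := tile_index_bij n; rewrite -(gK x) /=.
by rewrite -(tnth_nth 0%R (word_of v) (g x)) tnth_mktuple.
Qed.

Lemma word_of_inj (n q : nat) (t : 'Z_q) : injective (@word_of n q t).
Proof.
by move=> u v uv; apply/val_inj/ffunP => x; rewrite !nth_word_of uv.
Qed.

Lemma word_of_surj (n q : nat) (t : 'Z_q) (w : n.-tuple 'Z_q) :
  trace w = t -> exists v : vertex n t, word_of v = w.
Proof.
move=> wt; pose f : {ffun seq_sub (tile n) -> 'Z_q} :=
  [ffun x => nth 0%R w (ssval x).1].
have fE i : f (SeqSub (mem_tile i)) = tnth w i by rewrite ffunE (tnth_nth 0%R).
have fP : is_vertex t f.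
  by rewrite /is_vertex sum_tile -wt traceE; apply/eqP/eq_bigr.
by exists (exist _ f fP); apply: eq_from_tnth => i; rewrite tnth_mktuple fE.
Qed.

Lemma word_of_image (n q : nat) (t : 'Z_q) :
  [set word_of v | v : vertex n t] = words n t.
Proof.
apply/setP=> w; rewrite inE; apply/imsetP/eqP => [[v _ ->]|].
  exact: trace_word_of.
by case/word_of_surj=> v <-; exists v.
Qed.

(** The last [n] symbols are free and force the first to be [t] minus their trace; [h] prepends
    it. *)
Lemma card_words (n q : nat) (t : 'Z_q) :
  1 < q -> #|words n.+1 t| = q ^ n.
Proof.
move=> q_gt1; pose h (w : n.-tuple 'Z_q) := [tuple of (t - trace w)%R :: w].
have traceh w : trace (h w) = t by rewrite /trace big_cons subrK.
have <- : #|{: n.-tuple 'Z_q}| = q ^ n.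
  by rewrite card_tuple card_ord Zp_cast.
have injh : injective h by move=> u v /(congr1 val) [_ /val_inj].
rewrite -cardsT -(card_imset _ injh); apply: eq_card => w; rewrite inE.
apply/eqP/imsetP => [|[u _ -> //]]; case/tupleP: w => a u wt.
exists u => //; apply: val_inj => /=; congr (_ :: _).
by rewrite -wt /trace big_cons addrK.
Qed.

Lemma card_vertex (n q : nat) (t : 'Z_q) :
  0 < n -> 1 < q -> #|vertex n t| = q ^ n.-1.
Proof.
case: n => // n _ q_gt1; rewrite -(card_words n t q_gt1) -word_of_image.
by rewrite card_imset ?cardsT //; apply: word_of_inj.
Qed.

(** * Paths *)

(** The translates of the tile cover [tiles n m], so the restrictions to them determine a path. *)
Lemma path_ext (n q : nat) (t : 'Z_q) (m : nat * nat) (f g : dpath n t m) :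
  (forall l, path_vertex f l = path_vertex g l) -> f = g.
Proof.
move=> fg; apply/val_inj/ffunP => -[x xP].
have /allpairsP[[i l] /= [iT lm xil]] := xP.
have := congr1 (fun v : vertex n t => val v (SeqSub iT)) (fg (SeqSub lm)).
rewrite /= !ffunE => fgx.
by rewrite (_ : SeqSub xP = SeqSub (mem_tiles (SeqSub iT) (SeqSub lm))) //;
  apply: val_inj.
Qed.

Lemma word_of_path_vertex (n q : nat) (t : 'Z_q) (m : nat * nat)
    (f : dpath n t m) (l : seq_sub (box m)) (i : 'I_n) :
  tnth (word_of (path_vertex f l)) i =
  val f (SeqSub (mem_tiles (SeqSub (mem_tile i)) l)).
Proof. by rewrite tnth_mktuple /= ffunE. Qed.

(** One function [F] on the whole plane supplies all the vertices, which settles their agreement on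
    overlapping translates. *)
Lemma path_from_vertices (n q : nat) (t : 'Z_q) (m : nat * nat)
    (F : nat * nat -> 'Z_q) (v : seq_sub (box m) -> vertex n t) :
  (forall (l : seq_sub (box m)) (i : 'I_n),
     F (padd (val i, 0) (ssval l)) = tnth (word_of (v l)) i) ->
  exists f : dpath n t m, forall l, path_vertex f l = v l.
Proof.
move=> Fv; pose f : {ffun seq_sub (tiles n m) -> 'Z_q} :=
  [ffun x => F (ssval x)].
have restrE l : restr f l = val (v l).
  have [g _ gK] := tile_index_bij n.
  by apply/ffunP=> x; rewrite -(gK x) !ffunE Fv tnth_mktuple.
have fP : is_path t f.
  by apply/forallP=> l; rewrite restrE; apply: (valP (v l)).
by exists (exist _ f fP) => l; apply: val_inj; rewrite /= restrE.
Qed.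

(** * The red graph *)

Lemma box01P (l : seq_sub (box (0, 1))) :
  l = SeqSub (mem0_box (0, 1)) \/ l = SeqSub (memm_box (0, 1)).
Proof.
case: l => -[a b] lP; have := lP; rewrite mem_box leqn0.
by case: a b lP => // -[|[|]] // lP _; [left|right]; apply: val_inj.
Qed.

Lemma red_edge_unique (n q : nat) (t : 'Z_q) (u v : vert (red_graph n t)) :
  exists! f : edge (red_graph n t), rng f = v /\ src f = u.
Proof.
(* Row 0 carries the range and row 1 the source. *)
pose w (b : nat) := if b == 0 then v else u.
have [|f fE] := @path_from_vertices n q t (0, 1)
    (fun x => nth 0%R (word_of (w x.2)) x.1) (fun l => w (ssval l).2).
  move=> l i; rewrite (tnth_nth 0%R) /padd /=.
  by case: (box01P l) => -> /=; rewrite !addn0.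
exists f; split=> [|g [gv gu]].
  by split; [apply: (fE (SeqSub (mem0_box _))) | apply: (fE (SeqSub (memm_box _)))].
apply: path_ext => l; rewrite fE.
by case: (box01P l) => -> /=; apply/esym.
Qed.

Lemma red_graph_complete (n q : nat) (t : 'Z_q) :
  0 < n -> 1 < q ->
  digraph_iso (red_graph n t) (complete_digraph (q ^ n.-1)).
Proof.
move=> n_gt0 q_gt1; pose c := cast_ord (card_vertex t n_gt0 q_gt1).
pose f (x : vert (red_graph n t)) := c (enum_rank x).
have f_bij : bijective f.
  exists (fun i => enum_val (cast_ord (esym (card_vertex t n_gt0 q_gt1)) i)).
    by move=> x; rewrite /f /c cast_ordK enum_rankK.
  by move=> i; rewrite /f /c enum_valK cast_ordKV.
(* Edges of [complete_digraph] are pairs with the source first. *)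
exists f, (fun e => (f (src e), f (rng e))); split=> //.
have [f' fK f'K] := f_bij.
have injr : injective (fun e : edge (red_graph n t) => (f (src e), f (rng e))).
  move=> e e' ee'; have /= := (congr1 fst ee', congr1 snd ee').
  case=> /(can_inj fK) se /(can_inj fK) re.
  have [e0 [_ e0U]] := red_edge_unique (src e) (rng e).
  by rewrite -(e0U e) // (e0U e').
apply: inj_surj_bij => // -[i j].
have [e [[re se] _]] := red_edge_unique (f' i) (f' j).
by exists e; rewrite re se !f'K.
Qed.

(** * The blue graph *)

Lemma nth_rho (n q : nat) (w : n.-tuple 'Z_q) (i : nat) :
  i < n -> nth 0%R (rho w) i = nth 0%R w (i.+1 %% n).
Proof.
case: n w => // n; case/tupleP=> a u lt_in.
rewrite /= rot1_cons nth_rcons size_tuple.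
have:= lt_in; rewrite ltnS leq_eqVlt => /predU1P[->|lt_in'].
  by rewrite ltnn eqxx modnn.
by rewrite lt_in' modn_small.
Qed.

Lemma nth_iter_rho (n q : nat) (w : n.-tuple 'Z_q) (k i : nat) :
  i < n -> nth 0%R (iter k (@rho n q) w) i = nth 0%R w ((i + k) %% n).
Proof.
elim: k w => [|k IH] w lt_in; first by rewrite addn0 modn_small.
have n_gt0 := leq_ltn_trans (leq0n i) lt_in.
rewrite iterSr IH // nth_rho ?ltn_pmod //; congr nth.
by rewrite -addn1 modnDml addn1 addnS.
Qed.

Lemma trace_rho (n q : nat) (w : n.-tuple 'Z_q) : trace (rho w) = trace w.
Proof. by apply: perm_big; rewrite /= perm_rot. Qed.

Lemma iter_rho (n q : nat) (w : n.-tuple 'Z_q) : iter n (@rho n q) w = w.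
Proof.
apply: eq_from_tnth => i; rewrite !(tnth_nth 0%R) nth_iter_rho //.
by rewrite modnDr modn_small.
Qed.

(** The rotation [rho] carried over to vertices. The default [v] is never taken, because [rho]
    preserves the trace. *)
Definition shift (n q : nat) (t : 'Z_q) (v : vertex n t) : vertex n t :=
  odflt v [pick u | word_of u == rho (word_of v)].

Lemma word_of_shift (n q : nat) (t : 'Z_q) (v : vertex n t) :
  word_of (shift v) = rho (word_of v).
Proof.
have [u uE] : exists u : vertex n t, word_of u = rho (word_of v).
  by apply: word_of_surj; rewrite trace_rho trace_word_of.
rewrite /shift; case: pickP => [_ /eqP //|/(_ u)].
by rewrite uE eqxx.
Qed.

Lemma shift_inj (n q : nat) (t : 'Z_q) : injective (@shift n q t).
Proof.
move=> u v uv; apply/word_of_inj/rho_inj.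
by rewrite -!word_of_shift uv.
Qed.

(* The words of the two ends of a blue edge overlap in n - 1 symbols, and the
   common trace forces the remaining symbol. *)
Lemma blue_srcE (n q : nat) (t : 'Z_q) (e : edge (blue_graph n t)) :
  0 < n -> src e = shift (rng e).
Proof.
move=> n_gt0; apply: word_of_inj; rewrite word_of_shift.
set u := word_of (src e); set w := rho _.
have: trace u = trace w by rewrite trace_rho !trace_word_of.
(* Both symbols are the value of the path at [(i + 1, 0)]. *)
have uw (i : 'I_n) : i.+1 < n -> tnth u i = tnth w i.
  move=> lt_in; rewrite (tnth_nth 0%R w) nth_rho // modn_small //.
  rewrite -(tnth_nth 0%R _ (Ordinal lt_in)) !word_of_path_vertex.
  congr (val e _); apply: val_inj; congr pair.
  by rewrite /= addn1 addn0.
case: n n_gt0 t e @u @w uw => // n _ t e u w uw.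
rewrite !traceE !big_ord_recr /= => eq_sum; apply: eq_from_tnth => i.
have:= ltn_ord i; rewrite ltnS leq_eqVlt => /predU1P[i_n|]; last exact: uw.
rewrite (_ : i = ord_max); last exact: val_inj.
(* Cancelling the common symbols from the equal traces leaves the last one. *)
move: eq_sum; rewrite (eq_bigr (fun i => tnth w (widen_ord (leqnSn n) i))).
  exact: addrI.
by move=> j _; apply: uw; rewrite /= ltnS.
Qed.

Lemma box10P (l : seq_sub (box (1, 0))) :
  l = SeqSub (mem0_box (1, 0)) \/ l = SeqSub (memm_box (1, 0)).
Proof.
case: l => -[a b] lP; have := lP; rewrite mem_box leqn0 andbC.
by case: b a lP => // -[|[|]] // lP _; [left|right]; apply: val_inj.
Qed.

(** The range fixes the source and hence the edge. Conversely, extending the word of [v] with period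
    [n] gives an edge with range [v], since the extension read from position 1 is the rotated
    word. *)
Lemma blue_rng_bij (n q : nat) (t : 'Z_q) :
  0 < n -> bijective (@rng (blue_graph n t)).
Proof.
move=> n_gt0; apply: inj_surj_bij => [e e' ee'|v].
  apply: path_ext => l; case: (box10P l) => ->; first exact: ee'.
  change (src e = src e'); by rewrite !blue_srcE // ee'.
have [|f fE] := @path_from_vertices n q t (1, 0)
    (fun x => nth 0%R (word_of v) (x.1 %% n))
    (fun l => @iter (vertex n t) (ssval l).1 (@shift n q t) v).
  move=> l i; rewrite (iter_morph (@word_of_shift n q t)).
  by rewrite (tnth_nth 0%R) nth_iter_rho.
by exists f; apply: (fE (SeqSub (mem0_box _))).
Qed.

(** * Blue cycles and necklaces *)

Lemma order_rho_dvd (n q : nat) (w : n.-tuple 'Z_q) :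
  order (@rho n q) w %| n.
Proof. by rewrite -iter_eq_order ?iter_rho //; apply: rho_inj. Qed.

Lemma order_shift (n q : nat) (t : 'Z_q) (v : vertex n t) :
  order (@shift n q t) v = order (@rho n q) (word_of v).
Proof.
by apply/esym/order_morph; [apply: word_of_inj | apply: word_of_shift].
Qed.

Lemma mem_necklace (n q : nat) (w : n.-tuple 'Z_q) : w \in necklace w.
Proof. exact: orb_id. Qed.

Lemma card_necklace (n q : nat) (w : n.-tuple 'Z_q) :
  #|necklace w| = order (@rho n q) w.
Proof. exact: card_orb. Qed.

Lemma necklace_eq (n q : nat) (u w : n.-tuple 'Z_q) :
  u \in necklace w -> necklace u = necklace w.
Proof. by apply: orb_eq; apply: rho_inj. Qed.

Lemma trace_necklace (n q : nat) (u w : n.-tuple 'Z_q) :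
  u \in necklace w -> trace u = trace w.
Proof. by case/orbP=> k ->; elim: k => //= k; rewrite trace_rho. Qed.

(** The trace is constant on a necklace, so one representative decides inclusion in [words n t]. *)
Lemma necklacesP (n q : nat) (t : 'Z_q) (N : {set n.-tuple 'Z_q}) :
  reflect (exists2 w, trace w = t & N = necklace w) (N \in necklaces n t).
Proof.
rewrite inE; apply: (iffP andP) => [[/imsetP[w _ ->] /subsetP/(_ w)]|[w wt ->]].
  by move/(_ (mem_necklace w)); rewrite inE => /eqP; exists w.
split; first exact: imset_f.
by apply/subsetP=> u /trace_necklace; rewrite inE wt => ->.
Qed.

Definition blue_cycle (n q : nat) (t : 'Z_q) (v : vertex n t) :=
  @orb_cycle (blue_graph n t) (@shift n q t) v.

Lemma cycle_words_blue_cycle (n q : nat) (t : 'Z_q) (v : vertex n t) :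
  cycle_words (blue_cycle v) = necklace (word_of v).
Proof. by rewrite /cycle_words -(orb_morph (@word_of_shift n q t)). Qed.

(** Equal word sets put [u] on the cycle of [v], and orbits that meet coincide. *)
Lemma blue_cycle_inj (n q : nat) (t : 'Z_q) (u v : vertex n t) :
  cycle_words (blue_cycle u) = cycle_words (blue_cycle v) ->
  blue_cycle u = blue_cycle v.
Proof.
move=> uv; apply: (@orb_cycle_eq (blue_graph n t) _ (@shift_inj n q t)).
have: word_of u \in cycle_words (blue_cycle u) by apply/imset_f/orb_id.
by rewrite uv => /imsetP[x xv /word_of_inj ->].
Qed.

Lemma blue_cycles_of_lengthP (n q : nat) (t : 'Z_q) (d : nat)
    (C : {set vert (blue_graph n t)} * {set edge (blue_graph n t)}) :
  0 < n ->
  C \in cycles_of_length (blue_graph n t) d <->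
  exists2 v, order (@rho n q) (word_of v) = d & C = blue_cycle v.
Proof.
move=> n_gt0.
have P D := @cycles_of_lengthP (blue_graph n t) _ (@shift_inj n q t)
  (blue_rng_bij t n_gt0) (fun e => blue_srcE e n_gt0) d D.
by split=> [/P[v <- ->]|[v vd ->]]; [|apply/P]; exists v; rewrite ?order_shift.
Qed.

Lemma is_blue_cycleP (n q : nat) (t : 'Z_q)
    (C : {set vert (blue_graph n t)} * {set edge (blue_graph n t)}) :
  0 < n -> is_cycle C <-> exists v, C = blue_cycle v.
Proof.
by move=> n_gt0; apply: is_cycleP => [||e];
  [apply: shift_inj | apply: blue_rng_bij | apply: blue_srcE].
Qed.

(** [cycle_words] is a bijection between the two sets, as [word_of] preserves orders of rotation. *)
Lemma card_blue_cycles (n q : nat) (t : 'Z_q) (d : nat) :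
  0 < n ->
  #|cycles_of_length (blue_graph n t) d| =
  #|[set N in necklaces n t | #|N| == d]|.
Proof.
move=> n_gt0; rewrite -(@card_in_imset _ _ (@cycle_words n q t)); last first.
  move=> C C' /(blue_cycles_of_lengthP _ _ n_gt0)[u _ ->].
  by move=> /(blue_cycles_of_lengthP _ _ n_gt0)[v _ ->] /blue_cycle_inj.
apply: eq_card => N; rewrite inE; apply/imsetP/andP.
  case=> C /(blue_cycles_of_lengthP _ _ n_gt0)[v vd ->] ->.
  rewrite cycle_words_blue_cycle card_necklace vd eqxx; split=> //.
  by apply/necklacesP; exists (word_of v); rewrite ?trace_word_of.
case=> /necklacesP[w wt ->]; rewrite card_necklace => /eqP wd.
have [v vw] := word_of_surj wt; exists (blue_cycle v).
  by apply/blue_cycles_of_lengthP => //; exists v; rewrite ?vw.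
by rewrite cycle_words_blue_cycle vw.
Qed.

(** * Periodic words *)

(** For [d] dividing [n] this is the power [w ^ (n/d)]; indexing modulo [d] gives it length [n]
    without a cast. *)
Definition periodic_word (d n q : nat) (w : d.-tuple 'Z_q) : n.-tuple 'Z_q :=
  [tuple nth 0%R w (i %% d) | i < n].

Lemma nth_periodic_word (d n q : nat) (w : d.-tuple 'Z_q) (i : nat) :
  i < n -> nth 0%R (periodic_word n w) i = nth 0%R w (i %% d).
Proof.
by move=> lt_in; rewrite -(tnth_nth 0%R _ (Ordinal lt_in)) tnth_mktuple.
Qed.

Lemma periodic_word_inj (d n q : nat) :
  d <= n -> injective (@periodic_word d n q).
Proof.
move=> le_dn u w uw; apply: eq_from_tnth => i; rewrite !(tnth_nth 0%R).
have lt_in := leq_trans (ltn_ord i) le_dn.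
have := congr1 (fun x : n.-tuple _ => nth 0%R x i) uw.
by rewrite !nth_periodic_word // !modn_small.
Qed.

(** As [d] divides [n], reducing modulo [n] does not change residues modulo [d]. *)
Lemma periodic_word_rho (d n q : nat) (w : d.-tuple 'Z_q) :
  0 < d -> d %| n -> periodic_word n (rho w) = rho (periodic_word n w).
Proof.
move=> d_gt0 dn; apply: eq_from_tnth => i; rewrite !(tnth_nth 0%R).
have n_gt0 := leq_ltn_trans (leq0n i) (ltn_ord i).
rewrite nth_periodic_word // !nth_rho ?ltn_pmod // nth_periodic_word ?ltn_pmod //.
congr nth.
by rewrite (modn_dvdm _ dn) -[in LHS]addn1 modnDml addn1.
Qed.

Lemma trace_periodic_word (d n q : nat) (w : d.-tuple 'Z_q) :
  0 < d -> d %| n -> trace (periodic_word n w) = ((n %/ d)%:R * trace w)%R.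
Proof.
move=> d_gt0 /divnK <-; rewrite mulnK //; set k := n %/ d.
rewrite traceE.
under eq_bigr => i _ do rewrite tnth_mktuple.
(* The sum splits into [k] blocks of length [d], each equal to the trace of [w]. *)
rewrite -(big_mkord xpredT (fun i => nth 0%R w (i %% d))) big_nat_mul.
rewrite mulr_natl -{2}[k]subn0 -sumr_const_nat; apply: eq_bigr => j _.
rewrite mulSn -{1}[j * d]add0n big_addn addnK big_mkord traceE.
by apply: eq_bigr => i _; rewrite addnC modnMDl modn_small // (tnth_nth 0%R).
Qed.

(** The first [d] symbols serve: rotation by a multiple of [d] fixes [a], so its symbol at [i]
    equals that at [i %% d]. *)
Lemma periodic_wordP (d n q : nat) (a : n.-tuple 'Z_q) :
  0 < d -> d <= n -> iter d (@rho n q) a = a ->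
  exists w : d.-tuple 'Z_q, periodic_word n w = a.
Proof.
move=> d_gt0 le_dn a_d; exists [tuple nth 0%R a i | i < d].
apply: eq_from_tnth => i; rewrite !(tnth_nth 0%R) nth_periodic_word //.
rewrite -(tnth_nth 0%R _ (Ordinal (ltn_pmod i d_gt0))) tnth_mktuple /=.
have aM k : iter (k * d) (@rho n q) a = a.
  by elim: k => // k IH; rewrite mulSn iterD IH.
rewrite -[in LHS](aM (i %/ d)) nth_iter_rho.
  by rewrite addnC -divn_eq modn_small.
exact: leq_trans (ltn_pmod i d_gt0) le_dn.
Qed.

(** * Counting necklaces by Lyndon words *)

(** The order is an admissible exponent and divides every other one. *)
Lemma period_order (n q : nat) (w : n.-tuple 'Z_q) :
  period w = order (@rho n q) w.
Proof.
rewrite /period; case: ex_minnP => m /andP[m_gt0 m_iter] min_m.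
apply/eqP; rewrite eqn_leq; apply/andP; split.
  by apply: min_m; rewrite order_gt0 iter_order ?eqxx //; apply: rho_inj.
by rewrite dvdn_leq // -(iter_eq_order _ _ (@rho_inj n q)).
Qed.

Lemma lyndon_necklace_inj (n q : nat) (u w : n.-tuple 'Z_q) :
  lyndon u -> lyndon w -> w \in necklace u -> w = u.
Proof.
move=> /andP[_ /forall_inP minu] /andP[_ /forall_inP minw] uw.
have wu : u \in necklace w by rewrite (necklace_eq uw) mem_necklace.
by apply: (@Order.POrderTheory.le_anti _ (n.-tuplelexi 'Z_q));
  rewrite minu // minw.
Qed.

(** The lexicographic minimum of the necklace works: it has the same necklace, hence also period
    [n]. *)
Lemma lyndon_necklace_exists (n q : nat) (w : n.-tuple 'Z_q) :
  order (@rho n q) w = n -> exists2 u, lyndon u & u \in necklace w.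
Proof.
move=> wn.
have [u uw minu] := @Order.TotalTheory.arg_minP _ (n.-tuplelexi 'Z_q)
  _ w (mem (necklace w)) id (mem_necklace w).
have uE := necklace_eq uw.
exists u => //; apply/andP; split.
  by rewrite period_order -card_necklace uE card_necklace wn.
by apply/forall_inP => b; rewrite uE => /minu.
Qed.

(** Grouping Lyndon words by trace turns the sum into one cardinal, which a bijection can then
    reach. *)
Lemma sum_lyndon_count (d q k : nat) (t : 'Z_q) :
  (\sum_(s : 'Z_q | (k%:R * s == t)%R) lyndon_count d s)%N =
  #|[set w : d.-tuple 'Z_q | lyndon w && (k%:R * trace w == t)%R]|.
Proof.
rewrite -[RHS]sum1_card (partition_big (@trace d q) (fun s => k%:R * s == t)%R).
  apply: eq_bigr => s /eqP st; rewrite /lyndon_count -sum1_card.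
  apply: eq_bigl => w; rewrite !inE -andbA; congr (_ && _).
  by rewrite andbC; case: eqP => // ->; rewrite st eqxx.
by move=> w; rewrite inE => /andP[].
Qed.

Lemma card_necklaces_of_size (n q : nat) (t : 'Z_q) (d : nat) :
  0 < n -> d %| n ->
  #|[set N in necklaces n t | #|N| == d]| =
  (\sum_(s : 'Z_q | ((n %/ d)%:R * s == t)%R) lyndon_count d s)%N.
Proof.
move=> n_gt0 dn; have d_gt0 := dvdn_gt0 n_gt0 dn.
have le_dn := dvdn_leq n_gt0 dn.
have pw_rho := fun w => @periodic_word_rho d n q w d_gt0 dn.
have pw_inj := @periodic_word_inj d n q le_dn.
(* Powers commute with rotation, so necklaces and orders carry over from length [d] to length
   [n]. *)
have pw_necklace w : necklace (periodic_word n w) =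
    @periodic_word d n q @: necklace w.
  exact: orb_morph.
have pw_order w : order (@rho n q) (periodic_word n w) = order (@rho d q) w.
  exact: order_morph.
pose h (w : d.-tuple 'Z_q) := necklace (periodic_word n w).
rewrite sum_lyndon_count -(@card_in_imset _ _ h); last first.
  move=> u w; rewrite !inE => /andP[lu _] /andP[lw _] huw.
  apply: (lyndon_necklace_inj lw lu).
  have: periodic_word n u \in h w by rewrite -huw; apply: mem_necklace.
  by rewrite /h pw_necklace => /imsetP[x xw /pw_inj ->].
apply: eq_card => N; rewrite inE; apply/andP/imsetP; last first.
  case=> w; rewrite inE => /andP[/andP[/eqP pw _] /eqP wt] ->; split.
    by apply/necklacesP; exists (periodic_word n w); rewrite ?trace_periodic_word.
  by rewrite /h card_necklace pw_order -period_order pw.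
case=> /necklacesP[a at_ ->]; rewrite card_necklace => /eqP ad.
(* Since [d] rotations fix [a], it is a power of some [w], which has order [d] by [pw_order]; the
   Lyndon word on the necklace of [w] is the preimage sought. *)
have [|w wa] := periodic_wordP (a := a) d_gt0 le_dn.
  by rewrite -ad iter_order //; apply: rho_inj.
have [|u lu uw] := @lyndon_necklace_exists d q w; first by rewrite -pw_order wa.
have ua : h u = necklace a.
  by rewrite /h -wa !pw_necklace (necklace_eq uw).
exists u => //; rewrite inE lu -trace_periodic_word //=.
by rewrite trace_periodic_word // (trace_necklace uw) -trace_periodic_word // wa at_.
Qed.

Theorem proposition4p2 (n q : nat) (t : 'Z_q) (hn : 1 <= n) (hq : 2 <= q) :
  (digraph_iso (red_graph n t) (complete_digraph (q ^ n.-1)) /\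
   forall u v : vert (red_graph n t),
     exists! f : edge (red_graph n t), rng f = v /\ src f = u) /\
  (injective (@word_of n q t) /\
   [set word_of v | v : vertex n t] = words n t) /\
  (disjoint_union_of_cycles (blue_graph n t) /\
   (forall d C, C \in cycles_of_length (blue_graph n t) d -> d %| n) /\
   (forall C : {set vert (blue_graph n t)} * {set edge (blue_graph n t)},
      is_cycle C -> cycle_words C \in necklaces n t) /\
   (forall N : {set n.-tuple 'Z_q}, N \in necklaces n t ->
      exists! C : {set vert (blue_graph n t)} * {set edge (blue_graph n t)},
        is_cycle C /\ cycle_words C = N) /\
   (forall d : nat, d %| n ->
      #|cycles_of_length (blue_graph n t) d| =
      \sum_(s : 'Z_q | ((n %/ d)%:R * s == t)%R) lyndon_count d s)).
Proof.
split; first by split; [apply: red_graph_complete | apply: red_edge_unique].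
split; first by split; [apply: word_of_inj | apply: word_of_image].
split.
  apply: (@functional_disjoint_union_of_cycles (blue_graph n t) _
    (@shift_inj n q t) (blue_rng_bij t hn)) => e.
  exact: blue_srcE.
split=> [d C /(blue_cycles_of_lengthP _ _ hn)[v <- _]|].
  exact: order_rho_dvd.
split=> [C /(is_blue_cycleP _ hn)[v ->]|].
  rewrite cycle_words_blue_cycle; apply/necklacesP.
  by exists (word_of v); rewrite ?trace_word_of.
split=> [N /necklacesP[w wt ->]|d dn].
  have [v vw] := word_of_surj wt; exists (blue_cycle v).
  split=> [|C [/(is_blue_cycleP _ hn)[u ->] uw]].
    split; first by apply/is_blue_cycleP => //; exists v.
    by rewrite cycle_words_blue_cycle vw.
  by apply: blue_cycle_inj; rewrite uw cycle_words_blue_cycle vw.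
by rewrite card_blue_cycles // card_necklaces_of_size.
Qed.
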